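(* Let $p$ be an odd prime such that $p\equiv 1\pmod 3$ and let $n$ be an integer. Then we have the asymptotic formula $$\sum_{\chi \bmod p}|S_p(n;\chi)|^{4}=5p^3+O(p^{5/2}),$$ where the sum runs over all Dirichlet characters $\chi$ modulo $p$.
   Context: Write $e(y)=e^{2\pi i y}$. For a Dirichlet character $\chi$ modulo a prime $p$ and an integer $n$, the Kummer sum weighted by $\chi$ is $S_p(n;\chi)=\sum_{a=1}^{p}\chi(a)\,e\!\left(\frac{na^3}{p}\right)$. The notation $f=O(g)$ means $|f|\le c\cdot g$ for some constant $c$.
   Formalization: The formal theorem assumes additionally that p does not divide n: when p divides n (for example n = 0) the fourth moment equals (p-1)^4, so the stated formula fails; the constant is uniform in p and n. *)

(* Defs.v *)
From mathcomp Require Import all_boot all_order all_algebra cyclic.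
From mathcomp Require Import all_classical all_reals all_analysis.
From mathcomp.real_closed Require Import complex.

Set Implicit Arguments.
Unset Strict Implicit.
Unset Printing Implicit Defensive.
Import Order.TTheory GRing.Theory Num.Theory.
Local Open Scope classical_set_scope.
Local Open Scope complex_scope.
Local Open Scope ring_scope.

(* Dirichlet characters modulo q, as functions on the integers (characters of
   (Z/qZ)^* extended by zero). *)
Record dirichlet_character (R : realType) (q : nat) (chi : int -> R[i]) : Prop :=
  DirichletCharacter {
    dchar_periodic : forall a : int, chi (a + q%:Z) = chi a;
    dchar_multiplicative : forall a b : int, chi (a * b) = chi a * chi b;
    dchar_neq0 : forall a : int, (chi a != 0) = coprimez a q%:Z
  }.

Definition dirichlet_characters (R : realType) (q : nat) : set (int -> R[i]) :=
  [set chi | dirichlet_character q chi].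

Arguments dirichlet_characters : clear implicits.

(* e(y) = exp (2 pi i y) *)
Definition exp2ipi (R : realType) (y : R) : R[i] :=
  cos (2 * pi * y) +i* sin (2 * pi * y).

Definition kummer_sum (R : realType) (p : nat) (n : int) (chi : int -> R[i]) : R[i] :=
  \sum_(1 <= a < p.+1) chi a%:Z * exp2ipi ((n * a%:Z ^+ 3)%:~R / p%:R).

(* Sums \sum_(chi \in A) are 0 by convention when infinitely many terms are
   nonzero; the following shows that this never happens for
   A = dirichlet_characters R q. *)
Lemma finite_dirichlet_characters (R : realType) (q : nat) :
  (0 < q)%N -> finite_set (dirichlet_characters R q).
Proof.
move=> q_gt0.
pose P : {poly R[i]} := 'X * ('X^(totient q) - 1).
have P0 : P != 0.
  by rewrite mulf_neq0 ?polyX_eq0// -size_poly_gt0 size_XnsubC ?totient_gt0.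
have [rs rsE] := closed_field_poly_normal P.
have rsP x : root P x -> x \in rs.
  by rewrite rsE rootZ ?lead_coef_eq0// root_prod_XsubC.
have per (chi : int -> R[i]) : dirichlet_character q chi ->
    forall (a : int) (k : nat), chi (a + q%:Z *+ k) = chi a.
  move=> Hchi a; elim=> [|k IH]; first by rewrite mulr0n addr0.
  by rewrite mulrSr addrA (dchar_periodic Hchi).
have perz (chi : int -> R[i]) : dirichlet_character q chi ->
    forall a : int, chi a = chi (a %% q%:Z)%Z.
  move=> Hchi a; rewrite {1}(divz_eq a q%:Z); case: (a %/ q%:Z)%Z => k.
    by rewrite addrC -(per _ Hchi (a %% q%:Z)%Z k) -mulr_natl natz.
  rewrite -(per _ Hchi _ k.+1); congr (chi _).
  by rewrite NegzE -mulr_natl natz mulNr addrAC addNr add0r.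
have one (chi : int -> R[i]) : dirichlet_character q chi -> chi 1 = 1.
  move=> Hchi; have : chi 1 != 0 by rewrite (dchar_neq0 Hchi) coprimezE coprime1n.
  move=> h; apply: (mulfI h).
  by rewrite -(dchar_multiplicative Hchi) mulr1 mulr1.
have pw (chi : int -> R[i]) : dirichlet_character q chi ->
    forall (a : int) k, chi (a ^+ k) = chi a ^+ k.
  move=> Hchi a; elim=> [|k IH]; first by rewrite !expr0 one.
  by rewrite !exprS (dchar_multiplicative Hchi) IH.
have val_rs (chi : int -> R[i]) : dirichlet_character q chi ->
    forall a : nat, chi a%:Z \in rs.
  move=> Hchi a; apply: rsP; rewrite rootM !rootE !hornerE.
  have [->|/[dup] nz] := eqVneq (chi a%:Z) 0; first by [].
  rewrite (dchar_neq0 Hchi) coprimezE /= => cop.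
  have -> : chi a%:Z ^+ totient q = 1; last by rewrite subrr.
  rewrite -(pw _ Hchi) (perz _ Hchi) -rmorphXn /= modz_nat.
  rewrite (Euler_exp_totient cop) -modz_nat -(perz _ Hchi); exact: one.
pose ext (f : {ffun 'I_q -> seq_sub rs}) (a : int) : R[i] :=
  if insub `|(a %% q%:Z)%Z|%N is Some i then val (f i) else 0.
apply: (@sub_finite_set _ _ (ext @` setT)); last first.
  exact/finite_image/finite_finset.
move=> chi Hchi /=.
exists [ffun i : 'I_q => SeqSub (val_rs _ Hchi i)] => //.
apply/funext => a; rewrite /ext.
have m0 : (0 <= (a %% q%:Z)%Z) by rewrite modz_ge0// -lt0n.
have mq : (`|(a %% q%:Z)%Z| < q)%N.
  by rewrite -ltz_nat gez0_abs// ltz_pmod.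
by rewrite insubT /= ffunE /= gez0_abs// -perz.
Qed.

(* Main.v *)
Require Import Defs.
From mathcomp Require Import all_boot all_order all_algebra.
From mathcomp Require Import fingroup separable cyclic finfield cyclotomic.
From mathcomp Require Import all_classical all_reals all_analysis.
From mathcomp.real_closed Require Import complex.
From mathcomp Require Import ring lra.

Import Order.TTheory GRing.Theory Num.Theory.
Local Open Scope classical_set_scope.
Local Open Scope complex_scope.
Local Open Scope ring_scope.

Set Implicit Arguments.
Unset Strict Implicit.
Unset Printing Implicit Defensive.

(** Let N = p, let psi (x) = e (n x / p), a nontrivial additive character of
    the field F of N elements, and let G (m) be the sum of psi (m x^3) over
    the nonzero x. Put s = sqrt N.

    Opening |S (n; chi)|^2 and substituting a = t b gives
    |S (n; chi)|^2 = sum_(t != 0) chi (t) G (t^3 - 1)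
    ([sqr_norm_mulchar_sum]). This is a Fourier expansion on the cyclic group
    F^*, so Parseval turns the fourth moment into
    (N - 1) sum_(t != 0) |G (t^3 - 1)|^2 ([fourth_moment_mulchar]).

    The three cube roots of unity t contribute 3 (N - 1)^2. For the other t,
    G (t^3 - 1) is the sum G (k) at a nonzero k = t^3 - 1; detecting this
    equation by additive characters gives
      N sum_(t^3 != 1) |G (t^3 - 1)|^2 = sum_j G (j) H (-j) psi (-j),
      H (j) = sum_(k != 0) |G (k)|^2 psi (j k).
    The term j = 0 is (N - 1)^2 (2 N + 1), because the mean square of G is
    computed by counting solutions of x^3 = y^3 ([sum_sqr_norm_cubic_sum]).
    Together with the cube roots of unity this produces 5 N^3 at the end.

    The remaining terms are O (s^5), and the reason is that G depends only on
    the class of its argument modulo cubes. Two consequences follow.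
    Each value |G (m)|^2, m != 0, is repeated on the whole class of m, which
    has a third of the nonzero elements, so the mean square already forces
    |G (m)| <= 3 s ([norm_cubic_sum_le]). And for any phi bounded by B that
    depends only on the class modulo cubes, replacing k by k u^3 and averaging
    over u turns sum_k phi (k) psi (j k) into a mean of phi (k) G (j k), so
    that sum is at most 3 s B ([norm_twisted_sum_le]). This is applied
    once to |G|^2, which bounds H, and once to j |-> G (j) H (-j). *)

(** * Roots of unity and cubes in a finite field *)

Lemma ler_norm_sum_const (C : numDomainType) (I : finType) (P : {pred I})
    (f : I -> C) B :
  (forall i, P i -> `|f i| <= B) -> `|\sum_(i | P i) f i| <= #|P|%:R * B.
Proof.
move=> fB; apply: le_trans (ler_norm_sum _ _ _) _.
by rewrite mulr_natl -sumr_const; apply: ler_sum => i Pi; apply: fB.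
Qed.

Lemma finField_prim_root (F : finFieldType) :
  exists g : F, #|F|.-1.-primitive_root g.
Proof.
have N1 := finNzRing_gt1 F.
have /hasP[g _ gP] : has #|F|.-1.-primitive_root [seq x <- enum F | x != 0].
- apply: has_prim_root.
  + by rewrite -subn1 subn_gt0.
  + apply/allP => x; rewrite mem_filter => /andP[x0 _].
    apply/unity_rootP/(mulfI x0).
    by rewrite -exprS (ltn_predK N1) expf_card mulr1.
  + by rewrite filter_uniq ?enum_uniq.
  + by rewrite -(cardC1 (0 : F)) cardE enumT.
by exists g.
Qed.

Lemma numClosed_prim_root (C : numClosedFieldType) n : (0 < n)%N ->
  exists z : C, n.-primitive_root z.
Proof.
move=> n_gt0; pose P : {poly C} := 'X^n - 1.
have [r] := closed_field_poly_normal P.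
rewrite (monicP _) ?monicXnsubC// scale1r => Pr.
have rn1: all n.-unity_root r.
  by apply/allP => z; rewrite -root_prod_XsubC -Pr.
have sz_r: (n < (size r).+1)%N.
  by rewrite -(size_prod_XsubC r id) -Pr size_XnsubC.
have [|z _ zP] := hasP (has_prim_root n_gt0 rn1 _ sz_r); last by exists z.
by rewrite -separable_prod_XsubC -Pr separable_Xn_sub_1// pnatr_eq0 -lt0n.
Qed.


Section Cubes.
Variable F : finFieldType.
Hypothesis N3 : (3 %| #|F|.-1)%N.

Lemma card_nonzero : #|[pred x : F | x != 0]| = #|F|.-1.
Proof. exact: cardC1. Qed.

(** Since 3 divides the order of the cyclic group F^*, the cube roots of unity
    are the powers of an element of order 3. *)
Lemma card_cube_roots1 : #|[pred t : F | t ^+ 3 == 1]| = 3%N.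
Proof.
have [g gP] := finField_prim_root F.
have zP := dvdn_prim_root gP N3; set z := g ^+ _ in zP.
pose h (i : 'I_3) := z ^+ i.
have hI : injective h.
  move=> i j /eqP; rewrite /h (eq_prim_root_expr zP) !modn_small// => /eqP.
  exact: val_inj.
rewrite -[RHS](card_ord 3) -(card_codom hI); apply: eq_card => t.
apply/eqP/codomP => [/(prim_rootP zP)[i ->]|[i ->]]; first by exists i.
by rewrite /h exprAC (prim_expr_order zP) expr1n.
Qed.

Lemma card_cube_roots_cube y : y != 0 ->
  #|[pred x : F | (x != 0) && (x ^+ 3 == y ^+ 3)]| = 3%N.
Proof.
move=> y0; rewrite -[RHS]card_cube_roots1 -[RHS](fintype.card_image (mulfI y0)).
apply: eq_card => x; apply/idP/fintype.imageP => [/andP[x0 /eqP xy]|[t tP ->]].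
  exists (x / y); last by rewrite mulrC divfK.
  by rewrite inE expr_div_n xy divff// expf_neq0.
have /eqP t3 : t ^+ 3 == 1 := tP.
rewrite inE exprMn t3 mulr1 eqxx mulf_neq0//.
by apply: contra_eq_neq t3 => ->; rewrite expr0n eq_sym oner_neq0.
Qed.

(** The map u |-> m u^3 takes each value at most three times. *)
Lemma sum_cubes_le (C : numDomainType) (f : F -> C) m : m != 0 ->
  (forall k, k != 0 -> 0 <= f k) ->
  \sum_(u | u != 0) f (m * u ^+ 3) <= 3 * \sum_(k | k != 0) f k.
Proof.
move=> m0 f0.
rewrite (partition_big (fun u => m * u ^+ 3) (fun k => k != 0)) /=; last first.
  by move=> u u0; rewrite mulf_neq0 ?expf_neq0.
rewrite mulr_sumr; apply: ler_sum => k k0.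
rewrite (eq_bigr (fun=> f k)) => [|u /andP[_ /eqP->]//].
rewrite sumr_const -[leLHS]mulr_natl; apply: ler_wpM2r; first exact: f0.
rewrite ler_nat.
have [u /andP[u0 /eqP uk]|none] := pickP [pred u | (u != 0) && (m * u ^+ 3 == k)].
  rewrite -[leqRHS](card_cube_roots_cube u0); apply/eq_leq/eq_card => x.
  by rewrite unfold_in !inE -uk (inj_eq (mulfI m0)).
by rewrite eq_card0.
Qed.

End Cubes.

(** * Cubic exponential sums *)

Section AdditiveCharacters.
Variables (F : finFieldType) (C : numClosedFieldType) (psi : F -> C).

Record additive_character : Prop := AdditiveCharacter {
  addcharD : {morph psi : x y / x + y >-> x * y};
  addchar0 : psi 0 = 1;
  addchar_nontrivial : exists x, psi x != 1
}.

Hypothesis psiP : additive_character.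
Local Notation N := #|F|.

(** The values are roots of unity, because F is a finite additive group. *)
Lemma addchar_norm x : `|psi x| = 1.
Proof.
have [psiD psi0 _] := psiP.
have psiX k : psi (x *+ k) = psi x ^+ k.
  by elim: k => [|k IH]; rewrite ?mulr0n ?psi0// mulrS psiD IH exprS.
have xN : x *+ N = 0.
  by rewrite -FinRing.zmodXgE -cardsT (expg_cardG (G := [set: F]%G)) ?inE.
have : `|psi x| ^+ N == 1 by rewrite -normrX -psiX xN psi0 normr1.
by rewrite pexpr_eq1 ?normr_ge0 ?(ltnW (finNzRing_gt1 F))// => /eqP.
Qed.

Lemma addchar_conj x : (psi x)^* = psi (- x).
Proof.
have p0 : psi x != 0 by rewrite -normr_gt0 addchar_norm.
apply: (mulfI p0); rewrite -normCK addchar_norm expr1n -(addcharD psiP).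
by rewrite subrr (addchar0 psiP).
Qed.

(** Translating x by y / m multiplies the sum by psi y. *)
Lemma sum_addchar m : \sum_x psi (x * m) = (m == 0)%:R * N%:R.
Proof.
have [psiD psi0 [y yP]] := psiP.
have [->|m0] := eqVneq.
  rewrite mul1r -[RHS]sumr_const; apply: eq_bigr => x _.
  by rewrite mulr0 psi0.
rewrite mul0r; apply/eqP.
suff : (1 - psi y) * \sum_x psi (x * m) == 0.
  by rewrite mulf_eq0 subr_eq0 eq_sym (negPf yP).
rewrite mulrBl mul1r subr_eq0; apply/eqP; rewrite mulr_sumr.
rewrite (reindex_inj (addrI (y / m))) /=; apply: eq_bigr => x _.
by rewrite mulrDl divfK // psiD.
Qed.

Definition cubic_sum (m : F) : C := \sum_(x | x != 0) psi (m * x ^+ 3).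
Local Notation G := cubic_sum.

Lemma cubic_sum0 : G 0 = N.-1%:R.
Proof.
rewrite /cubic_sum -card_nonzero -sumr_const; apply: eq_bigr => x _.
by rewrite mul0r (addchar0 psiP).
Qed.

Lemma cubic_sumM_cube m u : u != 0 -> G (m * u ^+ 3) = G m.
Proof.
move=> u0; rewrite /cubic_sum [RHS](reindex_inj (mulfI u0)) /=.
apply: eq_big => [x|x _]; first by rewrite mulf_eq0 (negPf u0).
by rewrite exprMn [in RHS]mulrA.
Qed.

Lemma sqr_norm_cubic_sum k : `|G k| ^+ 2 =
  \sum_(x | x != 0) \sum_(y | y != 0) psi (k * (y ^+ 3 - x ^+ 3)).
Proof.
rewrite normCKC /cubic_sum rmorph_sum /= mulr_suml; apply: eq_bigr => x _.
rewrite mulr_sumr; apply: eq_bigr => y _.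
by rewrite addchar_conj -(addcharD psiP) mulrBr addrC.
Qed.

Hypothesis N3 : (3 %| N.-1)%N.

Let N1E : N%:R = N.-1%:R + 1 :> C.
Proof. by rewrite natr1 (ltn_predK (finNzRing_gt1 F)). Qed.

(** Over all k, opening the square counts the pairs of nonzero x, y with
    x^3 = y^3, that is 3 (N - 1) pairs, each with weight N; the term k = 0 is
    then removed. *)
Lemma sum_sqr_norm_cubic_sum :
  \sum_(k | k != 0) `|G k| ^+ 2 = N.-1%:R * (2 * N%:R + 1) :> C.
Proof.
have : \sum_k `|G k| ^+ 2 = 3 * N.-1%:R * N%:R.
  rewrite (eq_bigr _ (fun k _ => sqr_norm_cubic_sum k)) exchange_big /=.
  transitivity (\sum_(x : F | x != 0) (3 * N%:R : C)); last first.
    by rewrite sumr_const card_nonzero -mulr_natr; ring.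
  apply: eq_bigr => x x0; rewrite exchange_big /=.
  rewrite (eq_bigr _ (fun y _ => sum_addchar (y ^+ 3 - x ^+ 3))) -mulr_suml.
  congr (_ * _); rewrite -natr_sum; congr _%:R.
  rewrite -[RHS](card_cube_roots_cube N3 x0) -sum1_card.
  rewrite big_mkcond [RHS]big_mkcond; apply: eq_bigr => y _ /=.
  by rewrite subr_eq0 !inE; case: (y != 0); case: (_ == _).
rewrite (bigD1 0) //= cubic_sum0 normr_nat => h.
by rewrite -[LHS](addKr (N.-1%:R ^+ 2)) h N1E; ring.
Qed.

Variable s : C.
Hypotheses (s0 : 0 <= s) (sN : s ^+ 2 = N%:R).

Let N1_gt0 : 0 < N.-1%:R :> C.
Proof. by rewrite ltr0n -subn1 subn_gt0 finNzRing_gt1. Qed.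

(** The value |G m|^2 is also the value at all m u^3, so
    (N - 1) |G m|^2 is at most three times the mean square sum, which gives
    |G m|^2 <= 6 N + 3 <= 9 N. *)
Lemma norm_cubic_sum_le m : m != 0 -> `|G m| <= 3 * s.
Proof.
move=> m0; rewrite -ler_sqr ?nnegrE ?normr_ge0 ?mulr_ge0 ?ler0n//.
rewrite -(ler_pM2l N1_gt0).
have -> : N.-1%:R * `|G m| ^+ 2 = \sum_(u | u != 0) `|G (m * u ^+ 3)| ^+ 2.
  rewrite -card_nonzero mulr_natl -sumr_const; apply: eq_bigr => u u0.
  by rewrite cubic_sumM_cube.
apply: le_trans (sum_cubes_le N3 m0 (fun k _ => exprn_ge0 2 (normr_ge0 (G k)))) _.
rewrite sum_sqr_norm_cubic_sum mulrCA ler_pM2l// exprMn sN -subr_ge0.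
rewrite N1E [leRHS](_ : _ = 3 * N.-1%:R); last by ring.
by rewrite mulr_ge0 ?ler0n.
Qed.

(** Substituting k u^3 for k leaves phi unchanged; summing over all nonzero u
    replaces the character psi (j k) by the cubic sum G (j k), which already
    has size O (s). *)
Lemma norm_twisted_sum_le (phi : F -> C) B j : j != 0 ->
    (forall k u, u != 0 -> phi (k * u ^+ 3) = phi k) ->
    (forall k, k != 0 -> `|phi k| <= B) ->
  `|\sum_(k | k != 0) phi k * psi (j * k)| <= 3 * s * B.
Proof.
move=> j0 phiM phiB; set S := \sum_(k | _) _.
have avg : N.-1%:R * S = \sum_(k | k != 0) phi k * G (j * k).
  rewrite -card_nonzero mulr_natl -sumr_const.
  under [RHS]eq_bigr do rewrite mulr_sumr.
  rewrite [RHS]exchange_big /=; apply: eq_bigr => u u0.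
  have u30 : u ^+ 3 != 0 by rewrite expf_neq0.
  rewrite /S (reindex_inj (mulIf u30)) /=.
  apply: eq_big => [k|k _]; first by rewrite mulf_eq0 (negPf u30) orbF.
  by rewrite phiM// mulrA.
rewrite -(ler_pM2l N1_gt0) -[X in X * `|S|](ger0_norm (ltW N1_gt0)) -normrM avg.
rewrite -card_nonzero; apply: ler_norm_sum_const => k k0.
rewrite normrM mulrC ler_pM ?normr_ge0 ?phiB//.
by rewrite norm_cubic_sum_le// mulf_neq0.
Qed.

(** The sum over t with t^3 != 1 is a sum over the pairs (t, k) with
    k = t^3 - 1 != 0. Additive characters detect this equation, and the
    frequency j = 0 is the main term. For the other frequencies the
    coefficient of psi (- j) depends only on j modulo cubes, so that the
    averaging estimate applies to it; it also bounds that coefficient, and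
    3 s * (3 s * (3 s * (3 s)^2)) is the constant 243 s^5. *)
Lemma sum_sqr_norm_cubic_sum_cube :
  `|N%:R * (\sum_(t | t != 0) `|G (t ^+ 3 - 1)| ^+ 2) -
     N.-1%:R ^+ 2 * (5 * N%:R + 1)| <= 243 * s ^+ 5.
Proof.
(* the Fourier transform of |G|^2 on nonzero arguments *)
pose hat j := \sum_(k | k != 0) `|G k| ^+ 2 * psi (j * k).
have hat0 : hat 0 = N.-1%:R * (2 * N%:R + 1).
  rewrite -sum_sqr_norm_cubic_sum; apply: eq_bigr => k _.
  by rewrite mul0r (addchar0 psiP) mulr1.
have hatM j u : u != 0 -> hat (j * u ^+ 3) = hat j.
  move=> u0; have u30 : u ^+ 3 != 0 by rewrite expf_neq0.
  rewrite [RHS]/hat (reindex_inj (mulIf u30)) /=.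
  apply: eq_big => [k|k _]; first by rewrite mulf_eq0 (negPf u30) orbF.
  by rewrite cubic_sumM_cube// -mulrA (mulrC k).
have hat_le j : j != 0 -> `|hat j| <= 27 * s ^+ 3.
  move=> j0; rewrite [leRHS](_ : _ = 3 * s * (3 * s) ^+ 2); last by ring.
  apply: norm_twisted_sum_le => // [k u u0|k k0]; first by rewrite cubic_sumM_cube.
  by rewrite normrX normr_id lerXn2r ?nnegrE ?mulr_ge0 ?normr_ge0 ?norm_cubic_sum_le.
have main : N%:R * (\sum_(t | (t != 0) && (t ^+ 3 != 1)) `|G (t ^+ 3 - 1)| ^+ 2)
    = \sum_j G j * hat (- j) * psi (- j).
  transitivity (\sum_(t | t != 0) \sum_(k | k != 0)
      `|G k| ^+ 2 * \sum_j psi (j * (t ^+ 3 - 1 - k))).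
    rewrite big_mkcondr mulr_sumr /=.
    apply: eq_bigr => t _.
    under [RHS]eq_bigr do rewrite sum_addchar subr_eq0.
    have [t1|t1] := eqVneq (t ^+ 3) 1.
      rewrite mulr0 big1 // => k k0.
      by rewrite t1 subrr eq_sym (negPf k0) mul0r mulr0.
    rewrite (bigD1 (t ^+ 3 - 1)) ?subr_eq0 //= eqxx mul1r mulrC.
    rewrite big1 ?addr0 // => k /andP[_ kt].
    by rewrite eq_sym (negPf kt) mul0r mulr0.
  under eq_bigr do under eq_bigr do rewrite mulr_sumr.
  under eq_bigr do rewrite exchange_big /=.
  rewrite exchange_big /=; apply: eq_bigr => j _.
  rewrite /cubic_sum mulr_suml mulr_suml; apply: eq_bigr => t _.
  rewrite /hat mulr_sumr mulr_suml; apply: eq_bigr => k _.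
  have -> : j * (t ^+ 3 - 1 - k) = j * t ^+ 3 + (- j * k + - j) by ring.
  by rewrite !(addcharD psiP); ring.
have diag : \sum_(t | (t != 0) && (t ^+ 3 == 1)) `|G (t ^+ 3 - 1)| ^+ 2
    = 3 * N.-1%:R ^+ 2.
  have <- : #|[pred t : F | (t != 0) && (t ^+ 3 == 1 ^+ 3)]|%:R = 3 :> C.
    by rewrite (card_cube_roots_cube N3 (oner_neq0 F)).
  rewrite mulr_natl -sumr_const.
  apply: eq_big => [t|t /andP[_ /eqP->]]; first by rewrite !inE expr1n.
  by rewrite subrr cubic_sum0 normr_nat.
rewrite (bigID (fun t => t ^+ 3 == 1)) /= diag mulrDr main (bigD1 0) //=.
rewrite oppr0 cubic_sum0 hat0 (addchar0 psiP).
set E := \sum_(j | _) _.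
rewrite [X in `|X|](_ : _ = E); last by rewrite N1E; ring.
have -> : E = \sum_(j | j != 0) (G j * hat (- j)) * psi (- 1 * j).
  by apply: eq_bigr => j _; rewrite mulN1r.
rewrite [leRHS](_ : _ = 3 * s * (3 * s * (27 * s ^+ 3))); last by ring.
apply: norm_twisted_sum_le => [|j u u0|j j0]; first by rewrite oppr_eq0 oner_neq0.
  by rewrite cubic_sumM_cube// -mulNr hatM.
by rewrite normrM ler_pM ?normr_ge0 ?norm_cubic_sum_le ?hat_le ?oppr_eq0.
Qed.
End AdditiveCharacters.

(** * Parseval's identity on the multiplicative group *)

Section Parseval.
Variables (C : numClosedFieldType) (n : nat) (z : C).
Hypothesis zP : n.-primitive_root z.
Let n_gt0 : (0 < n)%N := prim_order_gt0 zP.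

Lemma conj_prim_root : z^* = z^-1.
Proof.
have z1 : `|z| = 1.
  have : `|z| ^+ n == 1 by rewrite -normrX prim_expr_order ?normr1.
  by rewrite pexpr_eq1 ?normr_ge0// => /eqP.
have z0 : z != 0 by rewrite -normr_gt0 z1.
by apply: (mulfI z0); rewrite -normCK z1 expr1n divff.
Qed.

Lemma sum_prim_root_orthogonal (i j : 'I_n) :
  \sum_(k < n) z ^+ (k * i) * (z ^+ (k * j))^* = (i == j)%:R * n%:R.
Proof.
have z0 : z != 0 by rewrite (prim_root_eq0 zP) -lt0n.
have zj0 k : z ^+ k != 0 by rewrite expf_neq0.
(* the sum over k is a geometric progression of ratio w *)
pose w := z ^+ i / z ^+ j.
transitivity (\sum_(k < n) w ^+ k).
  apply: eq_bigr => k _.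
  by rewrite rmorphXn /= conj_prim_root /w expr_div_n -!exprM exprVn !(mulnC k).
have [ij|ij] := eqVneq i j.
  rewrite mul1r /w ij -[in n%:R](card_ord n) -sumr_const; apply: eq_bigr => k _.
  by rewrite divff// expr1n.
have w1 : w - 1 != 0.
  rewrite subr_eq0 -(inj_eq (mulIf (zj0 j))) divfK// mul1r.
  by rewrite (eq_prim_root_expr zP) !modn_small.
rewrite mul0r; apply: (mulfI w1); rewrite mulr0 -subrX1 /w expr_div_n.
by rewrite !(exprAC z _ n) (prim_expr_order zP) !expr1n divr1 subrr.
Qed.

Lemma parseval (A : 'I_n -> C) :
  \sum_(k < n) `|\sum_(i < n) z ^+ (k * i) * A i| ^+ 2
    = n%:R * \sum_(i < n) `|A i| ^+ 2.
Proof.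
transitivity (\sum_(i < n) \sum_(j < n)
    (\sum_(k < n) z ^+ (k * i) * (z ^+ (k * j))^*) * (A i * (A j)^*)).
  under [RHS]eq_bigr do under eq_bigr do rewrite mulr_suml.
  under [RHS]eq_bigr do rewrite exchange_big /=.
  rewrite [RHS]exchange_big /=; apply: eq_bigr => k _.
  rewrite normCK rmorph_sum /= mulr_suml; apply: eq_bigr => i _.
  rewrite mulr_sumr; apply: eq_bigr => j _.
  by rewrite rmorphM /=; ring.
rewrite mulr_sumr; apply: eq_bigr => i _.
rewrite (bigD1 i) //= [X in _ + X]big1 ?addr0 => [|j ji];
  rewrite sum_prim_root_orthogonal.
  by rewrite eqxx mul1r normCK.
by rewrite eq_sym (negPf ji) !mul0r.
Qed.

End Parseval.

Section MultiplicativeCharacters.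
Variables (F : finFieldType) (C : numClosedFieldType) (g : F) (z : C).
Local Notation n := #|F|.-1.
Hypotheses (gP : n.-primitive_root g) (zP : n.-primitive_root z).

(** The discrete logarithm to base g; its value 0 at x = 0 is a dummy. *)
Definition dlog (x : F) : nat := odflt 0 (omap val [pick i : 'I_n | x == g ^+ i]).

(** The k-th power of the character sending g to z, extended by 0. *)
Definition mulchar (k : nat) (x : F) : C :=
  if x == 0 then 0 else z ^+ (k * dlog x).

Let n_gt0 : (0 < n)%N := prim_order_gt0 gP.

Let g0 i : g ^+ i != 0.
Proof. by rewrite expf_neq0// (prim_root_eq0 gP) -lt0n. Qed.

Lemma prim_root_surj x : x != 0 -> exists i : 'I_n, x = g ^+ i.
Proof.
move=> x0; have [|i ->] := prim_rootP gP (x := x); last by exists i.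
apply: (mulfI x0).
by rewrite -exprS (ltn_predK (finNzRing_gt1 F)) expf_card mulr1.
Qed.

Lemma mulchar_prim_root k i : mulchar k (g ^+ i) = z ^+ (k * i).
Proof.
rewrite /mulchar (negPf (g0 i)) /dlog; case: pickP => [j|none] /=.
  rewrite (eq_prim_root_expr gP) => ij.
  rewrite !(mulnC k) !exprM; congr (_ ^+ k); apply/eqP.
  by rewrite eq_sym (eq_prim_root_expr zP).
have [j ij] := prim_root_surj (g0 i).
by have := none j; rewrite -ij eqxx.
Qed.

Lemma mulchar0 k : mulchar k 0 = 0.
Proof. by rewrite /mulchar eqxx. Qed.

Lemma mulcharM k : {morph mulchar k : x y / x * y}.
Proof.
move=> x y; have [->|x0] := eqVneq x 0; first by rewrite mul0r mulchar0 mul0r.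
have [->|y0] := eqVneq y 0; first by rewrite mulr0 mulchar0 mulr0.
have [[i ->] [j ->]] := (prim_root_surj x0, prim_root_surj y0).
by rewrite -exprD !mulchar_prim_root mulnDr exprD.
Qed.

Lemma mulchar_conj k x : x != 0 -> mulchar k x * (mulchar k x)^* = 1.
Proof.
move=> /prim_root_surj[i ->]; rewrite mulchar_prim_root rmorphXn /=.
rewrite (conj_prim_root zP) exprVn divff// expf_neq0//.
by rewrite (prim_root_eq0 zP) -lt0n.
Qed.

Lemma sum_nonzero_prim_root (f : F -> C) :
  \sum_(x | x != 0) f x = \sum_(i < n) f (g ^+ i).
Proof.
rewrite (reindex (fun i : 'I_n => g ^+ i)) /=; last first.
  exists (fun x => odflt (Ordinal n_gt0) [pick i : 'I_n | x == g ^+ i]).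
    move=> i _; case: pickP => [j|/(_ i)]; last by rewrite eqxx.
    by rewrite (eq_prim_root_expr gP) !modn_small// => /eqP/val_inj.
  move=> x; rewrite inE => /prim_root_surj[i ->].
  by case: pickP => [j /eqP//|/(_ i)]; rewrite eqxx.
by apply: eq_bigl => i; rewrite g0.
Qed.

Lemma parseval_mulchar (A : F -> C) :
  \sum_(k < n) `|\sum_(x | x != 0) mulchar k x * A x| ^+ 2
    = n%:R * \sum_(x | x != 0) `|A x| ^+ 2.
Proof.
rewrite sum_nonzero_prim_root -(parseval zP); apply: eq_bigr => k _.
rewrite sum_nonzero_prim_root; congr (`|_| ^+ 2); apply: eq_bigr => i _.
by rewrite mulchar_prim_root.
Qed.

(** Expand the square and substitute x = t y: multiplicativity and
    |chi (y)| = 1 leave only chi (t). *)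
Lemma sqr_norm_mulchar_sum k (f : F -> C) :
  `|\sum_(x | x != 0) mulchar k x * f x| ^+ 2 =
  \sum_(t | t != 0) mulchar k t * \sum_(y | y != 0) f (t * y) * (f y)^*.
Proof.
under [RHS]eq_bigr do rewrite mulr_sumr.
rewrite [RHS]exchange_big normCKC rmorph_sum /= mulr_suml.
apply: eq_bigr => y y0; rewrite mulr_sumr (reindex_inj (mulIf y0)) /=.
apply: eq_big => [t|t _]; first by rewrite mulf_eq0 (negPf y0) orbF.
rewrite mulcharM rmorphM /= -[RHS]mulr1 -(mulchar_conj k y0); ring.
Qed.

(** The inner sum over y in the expansion of the squared norm is
    sum_y psi ((t^3 - 1) y^3), so Parseval applies to t |-> G (t^3 - 1). *)
Lemma fourth_moment_mulchar (psi : F -> C) : additive_character psi ->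
  \sum_(k < n) `|\sum_(x | x != 0) mulchar k x * psi (x ^+ 3)| ^+ 4
    = n%:R * \sum_(t | t != 0) `|cubic_sum psi (t ^+ 3 - 1)| ^+ 2.
Proof.
move=> psiP; rewrite -parseval_mulchar; apply: eq_bigr => k _.
rewrite -[4%N]/(2 * 2)%N exprM sqr_norm_mulchar_sum.
(* the squared norm is its own norm, which gives Parseval's left-hand side *)
rewrite -[X in X ^+ 2]ger0_norm -?sqr_norm_mulchar_sum ?exprn_ge0//.
rewrite sqr_norm_mulchar_sum; congr (`|_| ^+ 2); apply: eq_bigr => t _.
congr (_ * _); apply: eq_bigr => y _.
by rewrite addchar_conj// -(addcharD psiP); congr psi; ring.
Qed.

End MultiplicativeCharacters.

(** * Additive characters modulo p *)

Section StandardCharacter.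
Variable R : realType.

Lemma exp2ipiD : {morph @exp2ipi R : x y / x + y >-> x * y}.
Proof.
move=> x y; rewrite /exp2ipi mulrDr cosD sinD.
by apply/eqP; rewrite eq_complex /=; apply/andP; split; apply/eqP; ring.
Qed.

Lemma exp2ipi0 : exp2ipi (0 : R) = 1.
Proof. by rewrite /exp2ipi mulr0 cos0 sin0. Qed.

Lemma exp2ipi1 : exp2ipi (1 : R) = 1.
Proof. by rewrite /exp2ipi mulr1 mulr_natl cos2pi sin2pi. Qed.

Lemma exp2ipi_int (k : int) : exp2ipi (k%:~R : R) = 1.
Proof.
have pos (m : nat) : exp2ipi (m%:R : R) = 1.
  by elim: m => [|m IH]; rewrite ?exp2ipi0// -natr1 exp2ipiD IH exp2ipi1 mulr1.
case: k => m; first exact: pos.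
rewrite NegzE mulrNz -[LHS]mulr1 -[X in _ * X](pos m.+1) -exp2ipiD.
by rewrite addNr exp2ipi0.
Qed.

(** The angle 2 pi / p lies in [0, pi], where cos is injective. *)
Lemma exp2ipi_inv_neq1 (p : nat) : (1 < p)%N -> exp2ipi (p%:R^-1 : R) != 1.
Proof.
move=> p1; have p0 : 0 < p%:R :> R by rewrite ltr0n ltnW.
have pi0 := pi_gt0 R.
apply/eqP => -[cos1 _]; have : 2 * pi / p%:R = 0 :> R.
  apply: cos_inj; rewrite ?cos0 // in_itv /=.
    rewrite divr_ge0 ?ler0n ?mulr_ge0 ?pi_ge0//= ler_pdivrMr// mulrC.
    by rewrite ler_wpM2l ?pi_ge0// ler_nat.
  by rewrite lexx pi_ge0.
by apply/eqP; rewrite mulf_neq0 ?invr_neq0 ?gt_eqF// mulr_gt0.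
Qed.

Variable p : nat.
Hypothesis p_pr : prime p.

Definition standard_addchar (x : 'F_p) : R[i] := exp2ipi ((x : nat)%:R / p%:R).

Lemma Fp_intr_p : (p%:Z)%:~R = 0 :> 'F_p.
Proof. exact: pchar_Fp_0. Qed.

Lemma Fp_intr_eq (a b : int) :
  (a%:~R = b%:~R :> 'F_p) <-> exists k : int, a = b + k * p%:Z.
Proof.
split=> [ab|[k ->]]; last first.
  by rewrite intrD intrM Fp_intr_p mulr0 addr0.
have : (p %| a - b)%Z by rewrite (dvdz_pcharf (pchar_Fp p_pr)) intrB ab subrr.
by move=> /dvdzP[k abk]; exists k; rewrite -abk addrC subrK.
Qed.

Lemma Fp_nat_of_ord (x : 'F_p) : (x : nat)%:Z%:~R = x.
Proof. exact: natr_Zp. Qed.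

(** The representative in [0, p) may be replaced by any integer of the class,
    by periodicity of e. *)
Lemma standard_addchar_int (a : int) :
  standard_addchar a%:~R = exp2ipi (a%:~R / p%:R).
Proof.
have p0 : p%:R != 0 :> R by rewrite pnatr_eq0 -lt0n prime_gt0.
have [k ak] := (Fp_intr_eq a _).1 (esym (Fp_nat_of_ord a%:~R)).
rewrite [in RHS]ak [in RHS]intrD mulrDl exp2ipiD [in RHS]intrM mulfK//.
by rewrite exp2ipi_int mulr1.
Qed.

Lemma standard_addcharP (c : 'F_p) : c != 0 ->
  additive_character (fun x => standard_addchar (c * x)).
Proof.
move=> c0; split=> [x y||].
- rewrite mulrDr -[X in X + _]Fp_nat_of_ord -[X in _ + X]Fp_nat_of_ord -intrD.
  by rewrite !standard_addchar_int intrD mulrDl exp2ipiD -!standard_addchar_int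
             !Fp_nat_of_ord.
- by rewrite mulr0 [LHS](standard_addchar_int 0) mul0r exp2ipi0.
(* at c^-1 the value is e (1 / p) *)
exists c^-1; rewrite divff// [X in X != _](standard_addchar_int 1) mul1r.
exact/exp2ipi_inv_neq1/prime_gt1.
Qed.

Lemma sum_Fp (f : 'F_p -> R[i]) : \sum_x f x = \sum_(0 <= a < p) f a%:R.
Proof.
suff H m : m = (Zp_trunc (pdiv p)).+2 ->
    \sum_(x : 'F_p) f x = \sum_(0 <= a < m) f a%:R by apply/H/esym/Fp_cast.
by move=> ->; rewrite big_mkord; apply: eq_bigr => x _; rewrite natr_Zp.
Qed.

(** * Dirichlet characters modulo p *)

Section DirichletCharacters.
Variables (g : 'F_p) (z : R[i]).
Hypotheses (gP : #|'F_p|.-1.-primitive_root g) (zP : #|'F_p|.-1.-primitive_root z).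

Definition dchar (k : nat) (a : int) : R[i] := mulchar g z k a%:~R.

Lemma Fp_intr_neq0 (a : int) : (a%:~R != 0 :> 'F_p) = coprimez a p%:Z.
Proof.
rewrite -(dvdz_pcharf (pchar_Fp p_pr)) coprimezE coprime_sym.
by rewrite prime_coprime.
Qed.

Lemma dcharP k : dirichlet_character p (dchar k).
Proof.
split=> [a|a b|a].
- by rewrite /dchar intrD Fp_intr_p addr0.
- by rewrite /dchar intrM (mulcharM gP zP).
rewrite -Fp_intr_neq0 /dchar; have [->|a0] := eqVneq (a%:~R : 'F_p) 0.
  by rewrite mulchar0 eqxx.
apply/eqP => x0; have := mulchar_conj gP zP k a0.
by rewrite x0 mul0r => /esym/eqP; rewrite oner_eq0.
Qed.

Lemma dirichlet_character_Fp (chi : int -> R[i]) (a b : int) :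
  dirichlet_character p chi -> a%:~R = b%:~R :> 'F_p -> chi a = chi b.
Proof.
move=> chiP /Fp_intr_eq[k ->].
have nat_mul c (m : nat) : chi (c + m%:Z * p%:Z) = chi c.
  elim: m c => [|m IH] c; first by rewrite mul0r addr0.
  by rewrite -addn1 PoszD mulrDl mul1r addrA (dchar_periodic chiP).
case: k => m; first exact: nat_mul.
by rewrite -[LHS](nat_mul _ m.+1) NegzE mulNr subrK.
Qed.

Lemma dirichlet_character1 (chi : int -> R[i]) :
  dirichlet_character p chi -> chi 1 = 1.
Proof.
move=> chiP; have chi1 : chi 1 != 0.
  by rewrite (dchar_neq0 chiP) coprimezE coprime1n.
by apply: (mulfI chi1); rewrite -(dchar_multiplicative chiP) !mulr1.
Qed.

(** A Dirichlet character is determined by its value at the primitive root g,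
    and that value is a root of unity of order dividing p - 1, hence a power
    of z. *)
Lemma dchar_bij :
  set_bij `I_(#|'F_p|.-1) (dirichlet_characters R p) dchar.
Proof.
have gint : ((g : nat)%:Z)%:~R = g by rewrite Fp_nat_of_ord.
split=> [k _|k l|chi chiP] /=; first exact: dcharP.
  rewrite !inE /= => kn ln /(congr1 (fun chi => chi (g : nat)%:Z)).
  rewrite /dchar gint -[g]expr1 !(mulchar_prim_root gP zP) !muln1.
  by move/eqP; rewrite (eq_prim_root_expr zP) !modn_small// => /eqP.
have chiX (a : int) i : chi (a ^+ i) = chi a ^+ i.
  elim: i => [|i IH]; first by rewrite !expr0 dirichlet_character1.
  by rewrite !exprS (dchar_multiplicative chiP) IH.
have [k zk] : {k : 'I_(#|'F_p|.-1) | chi (g : nat)%:Z = z ^+ k}.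
  apply: (prim_rootP zP); rewrite -chiX -(dirichlet_character1 chiP).
  by apply: dirichlet_character_Fp => //; rewrite rmorphXn /= gint prim_expr_order.
exists (val k) => //=; apply/funext => a; rewrite /dchar.
have [a0|a0] := eqVneq (a%:~R : 'F_p) 0.
  rewrite a0 mulchar0; apply/esym/eqP/negPn.
  by rewrite (dchar_neq0 chiP) -Fp_intr_neq0 a0 eqxx.
have [i ai] := prim_root_surj gP a0.
rewrite ai (mulchar_prim_root gP zP) exprM -zk -chiX.
by apply: dirichlet_character_Fp => //; rewrite rmorphXn /= gint ai.
Qed.

(** The term a = p vanishes, so the sum runs over the nonzero classes. *)
Lemma kummer_sumE (n : int) k : kummer_sum p n (dchar k) =
  \sum_(x | x != 0) mulchar g z k x * standard_addchar (n%:~R * x ^+ 3).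
Proof.
rewrite /kummer_sum big_nat_recr ?prime_gt0//= [X in _ + X](_ : _ = 0) ?addr0; last first.
  by rewrite /dchar Fp_intr_p mulchar0 mul0r.
rewrite [RHS]big_mkcond /= sum_Fp [RHS]big_ltn ?prime_gt0// mulr0n eqxx /= add0r.
apply: eq_bigr => a _; rewrite -standard_addchar_int /dchar.
case: eqVneq => [a0|_] /=; last by rewrite intrM rmorphXn.
by rewrite (a0 : a%:Z%:~R = 0 :> 'F_p) mulchar0 mul0r.
Qed.

End DirichletCharacters.
End StandardCharacter.

(** * The asymptotic formula *)

(** Multiplied by N, the fourth moment (N - 1) T has the main term
    (N - 1)^3 (5 N + 1), which differs from 5 N^4 by at most
    14 N^3 = 14 s^6 <= 14 s^7; the constant is 257 = 243 + 14. *)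
Lemma fourth_moment_deviation (R : realFieldType) (N s T : R) :
  1 <= s -> s ^+ 2 = N ->
  `|N * T - (N - 1) ^+ 2 * (5 * N + 1)| <= 243 * s ^+ 5 ->
  `|(N - 1) * T - 5 * N ^+ 3| <= 257 * s ^+ 5.
Proof.
move=> s1 <-; set E := _ - _ => E_le.
have s2 : 1 <= s ^+ 2 by rewrite exprn_ege1.
have s0 : 0 < s ^+ 2 by apply: lt_le_trans s2.
rewrite -(ler_pM2l s0) -{1}(ger0_norm (ltW s0)) -normrM.
have -> : s ^+ 2 * ((s ^+ 2 - 1) * T - 5 * (s ^+ 2) ^+ 3) =
    (s ^+ 2 - 1) * E - (14 * s ^+ 6 - 12 * s ^+ 4 + 2 * s ^+ 2 + 1).
  by rewrite /E; ring.
apply: le_trans (ler_normB _ _) _.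
have -> : s ^+ 2 * (257 * s ^+ 5) = s ^+ 2 * (243 * s ^+ 5) + 14 * s ^+ 7 by ring.
apply: lerD.
  rewrite normrM ler_pM ?normr_ge0// ger0_norm ?subr_ge0//.
  by rewrite gerBl.
have s4 : s ^+ 2 <= s ^+ 4 by rewrite ler_weXn2l.
have s46 : s ^+ 4 <= s ^+ 6 by rewrite ler_weXn2l.
have s67 : s ^+ 6 <= s ^+ 7 by rewrite ler_weXn2l.
by rewrite ger0_norm; lra.
Qed.

Theorem theorem1p3 (R : realType) :
  exists c : R, forall (p : nat) (n : int),
    prime p -> odd p -> (p = 1 %[mod 3])%N -> ~~ (p%:Z %| n)%Z ->
    `| \sum_(chi \in dirichlet_characters R p)
         Normc.normc (kummer_sum p n chi) ^+ 4 - 5 * p%:R ^+ 3 |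
      <= c * p%:R `^ (5 / 2).
Proof.
exists 257 => p n p_pr _ p3 pn.
have cardE : #|'F_p| = p by rewrite card_Fp.
have N3 : (3 %| #|'F_p|.-1)%N.
  by rewrite cardE -subn1 -eqn_mod_dvd ?prime_gt0// p3.
have n0 : n%:~R != 0 :> 'F_p by rewrite -(dvdz_pcharf (pchar_Fp p_pr)).
have [g gP] := finField_prim_root 'F_p.
have [z zP] := numClosed_prim_root R[i] (prim_order_gt0 gP).
rewrite (reindex_fsbig _ _ _ _ (dchar_bij p_pr gP zP)) -fsbig_ord.
have psiP := standard_addcharP R p_pr n0; set psi := (fun _ => _) in psiP.
pose T : R := \sum_(t : 'F_p | t != 0) Normc.normc (cubic_sum psi (t ^+ 3 - 1)) ^+ 2.
have TE : T%:C = \sum_(t : 'F_p | t != 0) `|cubic_sum psi (t ^+ 3 - 1)| ^+ 2.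
  by rewrite rmorph_sum; apply: eq_bigr => t _; rewrite rmorphXn.
pose s : R := Num.sqrt p%:R.
have s1 : 1 <= s by rewrite -sqrtr1 ler_wsqrtr// ler1n prime_gt0.
have sN : s ^+ 2 = p%:R by rewrite sqr_sqrtr.
have -> : p%:R `^ (5 / 2) = s ^+ 5 :> R.
  by rewrite mulrC powRrM powR12_sqrt ?ler0n// powR_mulrn// sqrtr_ge0.
have -> : \sum_(k < #|'F_p|.-1) Normc.normc (kummer_sum p n (dchar g z k)) ^+ 4
    = (p%:R - 1) * T.
  apply: complexI; rewrite rmorphM /= TE.
  have -> : (p%:R - 1)%:C = #|'F_p|.-1%:R :> R[i].
    by rewrite cardE -subn1 natrB ?prime_gt0// rmorphB rmorph1 rmorph_nat.
  rewrite -(fourth_moment_mulchar gP zP psiP) rmorph_sum; apply: eq_bigr => k _.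
  by rewrite rmorphXn /= (kummer_sumE p_pr).
apply: fourth_moment_deviation => //.
have s0 : 0 <= s%:C by rewrite lecR ltW// (lt_le_trans ltr01).
have sNC : s%:C ^+ 2 = #|'F_p|%:R by rewrite -rmorphXn /= sN rmorph_nat cardE.
have := sum_sqr_norm_cubic_sum_cube psiP N3 s0 sNC.
rewrite -TE cardE -subn1 natrB ?prime_gt0//.
have -> : p%:R * T%:C - (p%:R - 1) ^+ 2 * (5 * p%:R + 1) =
    (p%:R * T - (p%:R - 1) ^+ 2 * (5 * p%:R + 1))%:C :> R[i].
  by rewrite !(rmorphB, rmorphM, rmorphXn, rmorphD, rmorph1, rmorph_nat).
have -> : 243 * s%:C ^+ 5 = (243 * s ^+ 5)%:C.
  by rewrite rmorphM rmorphXn rmorph_nat.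
by rewrite normc_def /= expr0n addr0 sqrtr_sqr lecR.
Qed.
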